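(* Assume that the limit $\alpha:=\lim_{j\to\infty}\frac{a_j}{\log j}\in[0,\infty]$ exists. For the approximation problem $\mathrm{APP}=\{\mathrm{APP}_s\}_{s\in\mathbb N}$ the following are equivalent: $\mathrm{APP}$ is SPT; $\mathrm{APP}$ is PT; $m_0=1$ and $\alpha>0$. If this is the case, then the exponent of SPT is $$p^*=\frac{2}{\alpha\,\log\omega^{-1}}.$$
   Context: Notation: $\mathbb N=\{1,2,\dots\}$, $\mathbb N_0=\{0,1,2,\dots\}$; $\log$ is the natural logarithm. For $\alpha=\infty$ the quotient $2/(\alpha\log\omega^{-1})$ is read as $0$. Setting. $H$ is an infinite-dimensional separable Hilbert space over $\mathbb R$ or $\mathbb C$ with orthonormal basis $\{e_k\}_{k\in\mathbb N_0}$; $\omega\in(0,1)$; $\boldsymbol m=\{m_k\}_{k\in\mathbb N_0}$ is a bounded sequence of positive integers; $r_0=0$ and $r_k=m_0+\cdots+m_{k-1}$ for $k\ge1$. For $n\in\mathbb N_0$ let $k(n)$ be the unique $k\in\mathbb N_0$ with $r_k\le n\le r_{k+1}-1$. For $a,b>0$ let $$H_{a,b}=\Big\{f\in H:\ \|f\|_{H_{a,b}}:=\Big(\sum_{k=0}^\infty\omega^{-ak^b}\sum_{j=r_k}^{r_{k+1}-1}|\langle f,e_j\rangle_H|^2\Big)^{1/2}<\infty\Big\}.$$ The sequences $\boldsymbol a=\{a_j\}_{j\in\mathbb N}$, $\boldsymbol b=\{b_j\}_{j\in\mathbb N}$ consist of positive reals with $0<a_1\le a_2\le\cdots$ and $\inf_jb_j>0$.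 Let $H_s=H\otimes\cdots\otimes H$ ($s$-fold Hilbert tensor product) with orthonormal basis $e_{\boldsymbol n}=e_{n_1}\otimes\cdots\otimes e_{n_s}$, $\boldsymbol n\in\mathbb N_0^s$, and $H_{s,\boldsymbol a,\boldsymbol b}=H_{a_1,b_1}\otimes\cdots\otimes H_{a_s,b_s}$; equivalently, $H_{s,\boldsymbol a,\boldsymbol b}$ is the set of $f\in H_s$ with $\|f\|_{H_{s,\boldsymbol a,\boldsymbol b}}^2=\sum_{\boldsymbol n\in\mathbb N_0^s}\omega^{-\sum_{j=1}^sa_j[k(n_j)]^{b_j}}|\langle f,e_{\boldsymbol n}\rangle_{H_s}|^2<\infty$. The operator $\mathrm{APP}_s:H_{s,\boldsymbol a,\boldsymbol b}\to H_s$ is the embedding $\mathrm{APP}_sf=f$. Information complexity. For $n\in\mathbb N_0$, $e(n,\mathrm{APP}_s)=\inf_{A_n}\sup_{\|f\|_{H_{s,\boldsymbol a,\boldsymbol b}}\le1}\|f-A_nf\|_{H_s}$, the infimum being over all algorithms $A_nf=\sum_{j=1}^nL_j(f)g_j$ with continuous linear functionals $L_j$ on $H_{s,\boldsymbol a,\boldsymbol b}$ and $g_j\in H_s$ ($A_0=0$). For $\varepsilon>0$, $n(\varepsilon,\mathrm{APP}_s)=\min\{n\in\mathbb N_0:\ e(n,\mathrm{APP}_s)\le\varepsilon\}$. PT (polynomial tractability) means that there are $C,p>0$ and $q\ge0$ such that $n(\varepsilon,\mathrm{APP}_s)\le C\,s^{q}\,\varepsilon^{-p}$ for all $s\in\mathbb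 N$, $\varepsilon\in(0,1)$. SPT (strong polynomial tractability) means that such a bound holds with $q=0$; the infimum of the $p$ in this bound (with $q=0$) is denoted $p^*$ and called the exponent of SPT. *)

(* Defs.v *)
From HB Require Import structures.
From mathcomp Require Import all_boot all_order all_algebra.
From mathcomp Require Import sesquilinear.
From mathcomp Require Import complex.
From mathcomp Require Import all_classical all_reals all_analysis.

Set Implicit Arguments.
Unset Strict Implicit.
Unset Printing Implicit Defensive.

Import Order.TTheory GRing.Theory Num.Theory.
Import numFieldNormedType.Exports.

Local Open Scope classical_set_scope.
Local Open Scope ring_scope.

Inductive scalar_kind := RealScalars | ComplexScalars.

Definition scalar_field (R : realType) (k : scalar_kind) : numFieldType :=
  match k with
  | RealScalars => R
  | ComplexScalars => R[i]
  end.

Definition conj_scalar (R : realType) (k : scalar_kind) :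
    scalar_field R k -> scalar_field R k :=
  match k with
  | RealScalars => idfun
  | ComplexScalars => @conjc R
  end.

Definition Re_scalar (R : realType) (k : scalar_kind) : scalar_field R k -> R :=
  match k with
  | RealScalars => idfun
  | ComplexScalars => @complex.Re R
  end.

(* The inner product is linear in its first argument. *)
Record hilbertSpace (R : realType) (k : scalar_kind) := HilbertSpace {
  hilbert_sort :> completeNormedModType (scalar_field R k);
  inner : {dot hilbert_sort for @conj_scalar R k};
  inner_norm : forall x : hilbert_sort, `|x| ^+ 2 = inner x x
}.

Section Hilbert.
Context {R : realType} {k : scalar_kind}.
Local Notation K := (scalar_field R k).

(* Norms take values in the scalar field; these are the real values. *)
Definition abs_scalar (z : K) : R := Re_scalar `|z|.
Definition hnorm (H : hilbertSpace R k) (x : H) : R := Re_scalar `|x|.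

Definition lin_span (V : lmodType K) (S : set V) : set V :=
  [set x | exists n (c : 'I_n -> K) (v : 'I_n -> V),
     (forall i, S (v i)) /\ x = \sum_(i < n) c i *: v i].

Definition orthonormal_basis (I : eqType) (H : hilbertSpace R k) (e : I -> H) :=
  (forall i j, inner H (e i) (e j) = (i == j)%:R) /\
  dense (lin_span (range e)).

(* Up to a unique isometric isomorphism compatible with [tens], these
   properties characterize the completion of the algebraic tensor power under
   the inner product that is multiplicative on elementary tensors. *)
Record is_hilbert_tensor_power (H : hilbertSpace R k) (s : nat)
    (Hs : hilbertSpace R k) (tens : ('I_s -> H) -> Hs) : Prop := {
  tens_multilinear : forall (x : 'I_s -> H) (j : 'I_s) (c : K) (u v : H),
    let put w := tens (fun i => if i == j then w else x i) in
    put (c *: u + v) = c *: put u + put v;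
  tens_inner : forall x y : 'I_s -> H,
    inner Hs (tens x) (tens y) = \prod_(j < s) inner H (x j) (y j);
  tens_dense : dense (lin_span (range tens))
}.

End Hilbert.

Definition block_start (m : nat -> nat) (k : nat) : nat := (\sum_(i < k) m i)%N.

(* This [k] exists and is unique as soon as every [m i] is positive. *)
Definition block_of (m : nat -> nat) (n : nat) : nat :=
  get [set k | (block_start m k <= n < block_start m k.+1)%N].

Section Approximation.
Context {R : realType} {k : scalar_kind}.
Local Notation K := (scalar_field R k).
Variables (omega : R) (m : nat -> nat) (a b : nat -> R).
Variables (H : hilbertSpace R k) (e : nat -> H).
Variables (s : nat) (Hs : hilbertSpace R k) (tens : ('I_s -> H) -> Hs).

Definition tensor_basis (n : {ffun 'I_s -> nat}) : Hs :=
  tens (fun j => e (n j)).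

(* [a] and [b] are indexed from 1, the coordinates [j : 'I_s] from 0. *)
Definition weight (n : {ffun 'I_s -> nat}) : R :=
  omega `^ (- \sum_(j < s) a j.+1 * (block_of m (n j))%:R `^ b j.+1).

Definition wnorm_sq (f : Hs) : \bar R :=
  \esum_(n in [set: {ffun 'I_s -> nat}])
    (weight n * abs_scalar (inner Hs f (tensor_basis n)) ^+ 2)%:E.

Definition wspace : set Hs := [set f | (wnorm_sq f < +oo)%E].

Definition wnorm (f : Hs) : R := Num.sqrt (fine (wnorm_sq f)).

(* The values of [L] outside [wspace] are irrelevant. *)
Definition cont_lin_functional (L : Hs -> K) : Prop :=
  (forall (c : K) (f g : Hs), wspace f -> wspace g ->
     L (c *: f + g) = c * L f + L g) /\
  (forall f : Hs, wspace f -> forall eps : R, 0 < eps ->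
     exists2 delta : R, 0 < delta &
       forall g : Hs, wspace g -> wnorm (g - f) < delta ->
         abs_scalar (L g - L f) < eps).

Definition linear_algorithm (n : nat) (A : Hs -> Hs) : Prop :=
  exists (L : 'I_n -> Hs -> K) (g : 'I_n -> Hs),
    (forall j, cont_lin_functional (L j)) /\
    A = fun f => \sum_(j < n) L j f *: g j.

Definition worst_case_error (A : Hs -> Hs) : \bar R :=
  ereal_sup [set (hnorm (f - A f))%:E
    | f in [set f : Hs | wspace f /\ wnorm f <= 1]].

Definition minimal_error (n : nat) : \bar R :=
  ereal_inf [set worst_case_error A | A in linear_algorithm n].

(* An infimum of natural numbers is attained; it is +oo if there is no such
   [n]. *)
Definition info_complexity (eps : R) : \bar R :=
  ereal_inf [set n%:R%:E | n in [set n : nat | (minimal_error n <= eps%:E)%E]].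

End Approximation.

Section Tractability.
Context {R : realType}.
(* [N s eps] is the information complexity of the [s]-variate problem. *)
Variable N : nat -> R -> \bar R.

Definition tractability_bound (C p q : R) : Prop :=
  forall (s : nat) (eps : R), (0 < s)%N -> 0 < eps < 1 ->
    (N s eps <= (C * s%:R `^ q * eps `^ (- p))%:E)%E.

Definition PT : Prop :=
  exists C p q : R, [/\ 0 < C, 0 < p, 0 <= q & tractability_bound C p q].

Definition SPT_exponents : set R :=
  [set p | 0 < p /\ exists2 C : R, 0 < C & tractability_bound C p 0].

Definition SPT : Prop := SPT_exponents !=set0.

Definition SPT_exponent : R := inf SPT_exponents.

End Tractability.

(* Main.v *)
Require Import Defs.
From HB Require Import structures.
From mathcomp Require Import all_boot all_order all_algebra.
From mathcomp Require Import sesquilinear.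
From mathcomp Require Import complex.
From mathcomp Require Import all_classical all_reals all_analysis.
From mathcomp Require Import ring lra zify.

Set Implicit Arguments.
Unset Strict Implicit.
Unset Printing Implicit Defensive.

Import Order.TTheory GRing.Theory Num.Theory.
Import numFieldNormedType.Exports.

Local Open Scope classical_set_scope.
Local Open Scope ring_scope.

(* Since the weighted norm is diagonal in the tensor basis, [n(eps, APP_s)] is
   the number of multi-indices [n] with [weight n < eps^-2]: projecting onto
   the corresponding basis vectors is good enough, and with fewer functionals
   some combination of them is invisible to the algorithm.

   Upper bound: by Markov this number is at most [eps^-p] times the sum of
   [weight n ^ (-p/2)], which factorizes over the coordinates. When [m_0 = 1]
   the [j]-th factor is at most [1 + B omega^(p a_j / 2)], so the product stays
   bounded in [s] as soon as [sum_j omega^(p a_j / 2) < oo], in particular for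
   [p > 2 / (alpha log omega^-1)].

   Lower bound: there are [C(s, d)] multi-indices with exactly [d] coordinates
   equal to [v] and the others [0]. For [v = m_0], the first index of block
   [1], their weights are at most [omega^(- d a_s)], and comparing powers of
   [s] gives [d <= q + (p/2) d alpha log omega^-1]. For [v = 1] in the case
   [m_0 >= 2], the weights are [1] and one gets [d <= q] for all [d]. *)

(** * Real and complex scalars *)

Section Scalars.
Variables (R : realType) (k : scalar_kind).
Local Notation K := (scalar_field R k).
Implicit Types z : K.

(** Radii of balls and scaling factors live in [K]; this is how real quantities re-enter it. *)
Definition scalar_of (x : R) : K :=
  match k return scalar_field R k with
  | RealScalars => x
  | ComplexScalars => x%:C%C
  end.

Lemma Re_scalar_of x : Re_scalar (scalar_of x) = x.
Proof. by rewrite /scalar_of /Re_scalar; case: k. Qed.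

Lemma Re_scalarD : {morph @Re_scalar R k : x y / x + y}.
Proof. by rewrite /Re_scalar; case: k => // -[? ?] [? ?]. Qed.

Lemma Re_scalar0 : Re_scalar (0 : K) = 0.
Proof. by rewrite /Re_scalar; case: k. Qed.

Lemma Re_scalar1 : Re_scalar (1 : K) = 1.
Proof. by rewrite /Re_scalar; case: k. Qed.

Lemma Re_scalar_le : {homo @Re_scalar R k : x y / x <= y}.
Proof.
rewrite /Re_scalar; case: k => //= x y.
by rewrite lecE => /andP[].
Qed.

Lemma scalar_of_gt0 x : (0 < scalar_of x) = (0 < x).
Proof. by rewrite /scalar_of; case: k => //; rewrite ltcR. Qed.

Lemma scalar_of_lt x y : (scalar_of x < scalar_of y) = (x < y).
Proof. by rewrite /scalar_of; case: k => //; rewrite ltcR. Qed.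

Lemma ge0_scalarE z : 0 <= z -> z = scalar_of (Re_scalar z).
Proof.
rewrite /Re_scalar /scalar_of; case: k z => //= -[x y].
by rewrite lecE /= => /andP[/eqP -> _].
Qed.

(** In the order on complex scalars a nonnegative element has zero imaginary part, so no cross term
    appears. *)
Lemma Re_scalarM z1 z2 : 0 <= z1 -> 0 <= z2 ->
  Re_scalar (z1 * z2) = Re_scalar z1 * Re_scalar z2.
Proof.
rewrite /Re_scalar; case: k z1 z2 => //= -[x1 y1] [x2 y2].
by rewrite !lecE /= => /andP[/eqP -> _] /andP[/eqP -> _]; rewrite mulr0 subr0.
Qed.

Lemma abs_scalar_ge0 z : 0 <= abs_scalar z.
Proof. by rewrite -Re_scalar0; apply: Re_scalar_le. Qed.

Lemma abs_scalar0 : abs_scalar (0 : K) = 0.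
Proof. by rewrite /abs_scalar normr0 Re_scalar0. Qed.

Lemma abs_scalarM z1 z2 : abs_scalar (z1 * z2) = abs_scalar z1 * abs_scalar z2.
Proof. by rewrite /abs_scalar normrM Re_scalarM. Qed.

Lemma abs_scalarD z1 z2 : abs_scalar (z1 + z2) <= abs_scalar z1 + abs_scalar z2.
Proof. by rewrite /abs_scalar -Re_scalarD; apply/Re_scalar_le/ler_normD. Qed.

Lemma scalar_of_ge0 x : (0 <= scalar_of x) = (0 <= x).
Proof. by rewrite /scalar_of; case: k => //; rewrite lecR. Qed.

Lemma abs_scalar_of x : 0 <= x -> abs_scalar (scalar_of x) = x.
Proof.
by move=> x0; rewrite /abs_scalar ger0_norm ?scalar_of_ge0// Re_scalar_of.
Qed.

Lemma conj_scalar0 : conj_scalar (0 : K) = 0.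
Proof. by rewrite /conj_scalar; case: k => //; rewrite conjc0. Qed.

Lemma mul_conj_scalar z : z * conj_scalar z = `|z| ^+ 2.
Proof.
rewrite /conj_scalar; case: k z => /= z; last exact/esym/(sqr_normc (z : R[i])).
by rewrite real_normK ?num_real.
Qed.

End Scalars.
Arguments scalar_of {R} k x.

(** * Orthonormal families in Hilbert spaces *)

Section HilbertSpaces.
Variables (R : realType) (k : scalar_kind) (H : hilbertSpace R k).
Local Notation K := (scalar_field R k).
Local Notation "<< x , y >>" := (inner H x y).

Lemma innerDl x y z : <<x + y, z>> = <<x, z>> + <<y, z>>.
Proof. exact: linearDl. Qed.

Lemma innerBl x y z : <<x - y, z>> = <<x, z>> - <<y, z>>.
Proof. exact: linearBl. Qed.

Lemma innerZl c x z : <<c *: x, z>> = c * <<x, z>>.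
Proof. exact: linearZl_LR. Qed.

Lemma innerDr x y z : <<z, x + y>> = <<z, x>> + <<z, y>>.
Proof. exact: linearDr. Qed.

Lemma innerZr c x z : <<z, c *: x>> = conj_scalar c * <<z, x>>.
Proof. exact: linearZr_LR. Qed.

Lemma inner0l z : <<0, z>> = 0.
Proof. exact: linear0l. Qed.

Lemma inner_suml I (r : seq I) F z :
  <<\sum_(i <- r) F i, z>> = \sum_(i <- r) <<F i, z>>.
Proof. exact: linear_sumlz. Qed.

Lemma inner_sumr I (r : seq I) F z :
  <<z, \sum_(i <- r) F i>> = \sum_(i <- r) <<z, F i>>.
Proof. exact: linear_sumr. Qed.

Lemma inner_eq0C x y : <<x, y>> = 0 -> <<y, x>> = 0.
Proof.
have -> : <<y, x>> = (-1) ^+ false * conj_scalar <<x, y>>.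
  exact: hermitian_subproof.
by move=> ->; rewrite conj_scalar0 mulr0.
Qed.

Lemma hnorm_ge0 (x : H) : 0 <= hnorm x.
Proof. by rewrite -(@Re_scalar0 R k); apply: Re_scalar_le. Qed.

Lemma hnorm_sq (x : H) : hnorm x ^+ 2 = Re_scalar <<x, x>>.
Proof. by rewrite -inner_norm !expr2 Re_scalarM. Qed.

Lemma hnormD (x y : H) : hnorm (x + y) <= hnorm x + hnorm y.
Proof. by rewrite /hnorm -Re_scalarD; apply/Re_scalar_le/ler_normD. Qed.

Lemma hnormZ (c : K) (x : H) : hnorm (c *: x) = abs_scalar c * hnorm x.
Proof. by rewrite /hnorm normrZ Re_scalarM. Qed.

Lemma hnorm_gt0 (x : H) : x != 0 -> 0 < hnorm x.
Proof.
move=> x0; rewrite -(scalar_of_gt0 k) -ge0_scalarE ?normr_ge0//.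
by rewrite normr_gt0.
Qed.

Lemma hnormD_sq (x y : H) : <<x, y>> = 0 ->
  hnorm (x + y) ^+ 2 = hnorm x ^+ 2 + hnorm y ^+ 2.
Proof.
move=> xy0; rewrite !hnorm_sq innerDl !innerDr xy0 (inner_eq0C xy0) addr0 add0r.
exact: Re_scalarD.
Qed.

Lemma dense_hnorm (S : set H) (x : H) (eta : R) : dense S -> 0 < eta ->
  exists2 y, S y & hnorm (x - y) < eta.
Proof.
move=> dS eta0.
have e0 : 0 < scalar_of k eta by rewrite scalar_of_gt0.
have [|y [xy Sy]] := dS (ball x (scalar_of k eta)) _ (ball_open x _).
  by exists x; exact: ballxx.
exists y => //; move: xy; rewrite -ball_normE /ball_ /=.
by rewrite [`|x - y|]ge0_scalarE ?normr_ge0// scalar_of_lt.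
Qed.

Section Orthonormal.
Variables (I : eqType) (u : I -> H).
Hypothesis u_orthonormal : forall i j, <<u i, u j>> = (i == j)%:R.

(** Indices may repeat, so that adding two combinations is concatenating their lists. *)
Definition lcomb (l : seq (K * I)) : H := \sum_(p <- l) p.1 *: u p.2.

(** This is the orthogonal projection only when [l] has no repetition, hence the [uniq] hypotheses
    below. *)
Definition proj (l : seq I) (x : H) : H := \sum_(i <- l) <<x, u i>> *: u i.

(** Membership in the closed linear span of the family, with a real-valued error. *)
Definition approximable (x : H) : Prop :=
  forall eta : R, 0 < eta -> exists l, hnorm (x - lcomb l) < eta.

Lemma inner_lcomb (l : seq I) (c : I -> K) (i : I) : uniq l ->
  <<\sum_(j <- l) c j *: u j, u i>> = if i \in l then c i else 0.
Proof.
move=> ul; rewrite inner_suml.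
under eq_bigr do rewrite innerZl u_orthonormal.
case: ifPn => il.
  rewrite (bigD1_seq i)//= eqxx mulr1 big1 ?addr0// => j /negPf ->.
  by rewrite mulr0.
rewrite big_seq big1// => j jl; case: eqP => [ji|]; last by rewrite mulr0.
by rewrite -ji jl in il.
Qed.

Lemma hnorm_lcomb_sq (l : seq I) (c : I -> K) : uniq l ->
  hnorm (\sum_(i <- l) c i *: u i) ^+ 2 = \sum_(i <- l) abs_scalar (c i) ^+ 2.
Proof.
move=> ul; rewrite hnorm_sq inner_sumr.
rewrite (big_morph _ (@Re_scalarD R k) (@Re_scalar0 R k)).
rewrite big_seq [RHS]big_seq; apply: eq_bigr => i il.
by rewrite innerZr inner_lcomb// il mulrC mul_conj_scalar !expr2 Re_scalarM.
Qed.

Lemma proj_orthogonal (l : seq I) (x : H) (i : I) : uniq l -> i \in l ->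
  <<x - proj l x, u i>> = 0.
Proof. by move=> ul il; rewrite innerBl inner_lcomb// il subrr. Qed.

Lemma proj_orthogonal_lcomb (l : seq I) (x : H) (l' : seq (K * I)) : uniq l ->
  {subset [seq p.2 | p <- l'] <= l} -> <<x - proj l x, lcomb l'>> = 0.
Proof.
move=> ul sub; rewrite inner_sumr big_seq big1// => p pl'.
by rewrite innerZr proj_orthogonal ?mulr0//; apply/sub/map_f.
Qed.

Lemma proj_lcomb (l : seq I) (x : H) :
  proj l x = lcomb [seq (<<x, u i>>, i) | i <- l].
Proof. by rewrite /lcomb big_map. Qed.

Lemma lcomb_cat l l' : lcomb (l ++ l') = lcomb l + lcomb l'.
Proof. by rewrite /lcomb big_cat. Qed.

Lemma lcomb_scale (c : K) l :
  lcomb [seq (c * p.1, p.2) | p <- l] = c *: lcomb l.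
Proof.
by rewrite /lcomb big_map scaler_sumr; apply: eq_bigr => p _; rewrite scalerA.
Qed.

Lemma hnorm_proj_sq (l : seq I) (x : H) : uniq l ->
  hnorm x ^+ 2 =
  hnorm (x - proj l x) ^+ 2 + \sum_(i <- l) abs_scalar <<x, u i>> ^+ 2.
Proof.
move=> ul; rewrite -(hnorm_lcomb_sq _ ul) -hnormD_sq ?subrK//.
rewrite -/(proj l x) {2}proj_lcomb proj_orthogonal_lcomb// => i.
by rewrite -map_comp /= map_id.
Qed.

(** Best approximation by Pythagoras: the residual of the projection is orthogonal to the span of
    [l], which contains [proj l x - lcomb l']. *)
Lemma hnorm_proj_le (l : seq I) (x : H) (l' : seq (K * I)) : uniq l ->
  {subset [seq p.2 | p <- l'] <= l} ->
  hnorm (x - proj l x) <= hnorm (x - lcomb l').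
Proof.
move=> ul sub.
rewrite -(@ler_pXn2r _ 2) ?nnegrE ?hnorm_ge0//.
have -> : x - lcomb l' = (x - proj l x) + (proj l x - lcomb l').
  by rewrite addrA subrK.
rewrite [leRHS]hnormD_sq ?lerDl ?sqr_ge0//.
rewrite {2}proj_lcomb -[- lcomb l']scaleN1r -lcomb_scale -lcomb_cat.
apply: proj_orthogonal_lcomb => // i.
rewrite map_cat mem_cat -!map_comp => /orP[|].
  by rewrite (eq_map (_ : _ =1 id)) ?map_id.
by rewrite (eq_map (_ : _ =1 snd)) => [/sub|[]].
Qed.

Lemma approximable_proj (x : H) (eta : R) : approximable x -> 0 < eta ->
  exists2 l, uniq l & hnorm (x - proj l x) < eta.
Proof.
move=> ax /ax[l' xl']; exists (undup [seq p.2 | p <- l']).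
  exact: undup_uniq.
apply: le_lt_trans xl'; apply: hnorm_proj_le; first exact: undup_uniq.
by move=> i; rewrite mem_undup.
Qed.

End Orthonormal.

(** * The closed linear span of a family *)

Section Approximable.
Variables (I : eqType) (u : I -> H).
Local Notation approx := (approximable u).

Lemma approximable_basis i : approx (u i).
Proof.
move=> eta eta0; exists [:: (1, i)].
rewrite /lcomb big_seq1 scale1r subrr.
by rewrite /hnorm normr0 Re_scalar0.
Qed.

Lemma approximable0 : approx 0.
Proof.
move=> eta eta0; exists [::].
by rewrite /lcomb big_nil subrr /hnorm normr0 Re_scalar0.
Qed.

Lemma approximableD x y : approx x -> approx y -> approx (x + y).
Proof.
move=> ax ay eta eta0; have eta20 : 0 < eta / 2 by rewrite divr_gt0.
have [[l xl] [l' yl']] := (ax _ eta20, ay _ eta20).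
exists (l ++ l'); rewrite lcomb_cat opprD addrACA.
apply: le_lt_trans (hnormD _ _) _.
by rewrite (splitr eta) ltrD.
Qed.

Lemma approximableZ c x : approx x -> approx (c *: x).
Proof.
move=> ax eta eta0.
have c1 : 0 < abs_scalar c + 1 by rewrite ltr_wpDl ?abs_scalar_ge0.
have [l xl] := ax (eta / (abs_scalar c + 1)) (divr_gt0 eta0 c1).
exists [seq (c * p.1, p.2) | p <- l].
rewrite lcomb_scale -scalerBr hnormZ.
apply: (@le_lt_trans _ _ ((abs_scalar c + 1) * hnorm (x - lcomb u l))).
  by rewrite ler_wpM2r ?hnorm_ge0// lerDl.
by rewrite -ltr_pdivlMl// mulrC.
Qed.

Lemma approximable_sum J (r : seq J) F : (forall j, approx (F j)) ->
  approx (\sum_(j <- r) F j).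
Proof.
move=> aF; elim/big_ind: _ => //; first exact: approximable0.
exact: approximableD.
Qed.

Lemma approximable_lim x :
  (forall eta : R, 0 < eta -> exists2 y, approx y & hnorm (x - y) < eta) ->
  approx x.
Proof.
move=> xlim eta eta0; have eta20 : 0 < eta / 2 by rewrite divr_gt0.
have [y ay xy] := xlim _ eta20; have [l yl] := ay _ eta20.
exists l; rewrite -(subrK y x) -addrA.
by apply: le_lt_trans (hnormD _ _) _; rewrite (splitr eta) ltrD.
Qed.

End Approximable.
End HilbertSpaces.

(** * The tensor basis *)

Section TensorBasis.
Variables (R : realType) (k : scalar_kind) (H : hilbertSpace R k).
Variables (e : nat -> H) (he : orthonormal_basis e).
Variables (s : nat) (Hs : hilbertSpace R k) (tens : ('I_s -> H) -> Hs).
Hypothesis htens : is_hilbert_tensor_power tens.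
Local Notation K := (scalar_field R k).
Local Notation u := (tensor_basis e tens).

Lemma tensor_basis_orthonormal n n' : inner Hs (u n) (u n') = (n == n')%:R.
Proof.
rewrite (tens_inner htens); under eq_bigr do rewrite (he.1).
have [->|nn'] := eqVneq n n'; first by rewrite big1// => j _; rewrite eqxx.
have [j nj] : exists j, n j != n' j.
  apply/existsP; rewrite -negb_forall; apply: contra nn' => /forallP nn'.
  by apply/eqP/ffunP => j; apply/eqP.
by rewrite (bigD1 j)//= (negPf nj) mul0r.
Qed.

Let put (x : 'I_s -> H) (j : 'I_s) (w : H) :=
  fun i => if i == j then w else x i.

Lemma tens_putP x j c v w :
  tens (put x j (c *: v + w)) = c *: tens (put x j v) + tens (put x j w).
Proof. exact: (tens_multilinear htens). Qed.

Lemma tens_put0 x j : tens (put x j 0) = 0.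
Proof.
have /eqP := tens_putP x j 1 0 0.
by rewrite !scale1r addr0 -subr_eq0 opprD addrA subrr add0r oppr_eq0 => /eqP.
Qed.

Lemma tens_putB x j v w :
  tens (put x j (v - w)) = tens (put x j v) - tens (put x j w).
Proof. by rewrite addrC -scaleN1r tens_putP scaleN1r addrC. Qed.

Lemma tens_put_lcomb x j n (c : 'I_n -> K) (v : 'I_n -> H) :
  tens (put x j (\sum_(i < n) c i *: v i)) =
  \sum_(i < n) c i *: tens (put x j (v i)).
Proof.
elim/big_rec2: _ => [|i y1 y2 _ <-]; first exact: tens_put0.
exact: tens_putP.
Qed.

Lemma hnorm_tens x : hnorm (tens x) = \prod_(j < s) hnorm (x j).
Proof.
apply: (@pexpIrn _ 2) => //; rewrite ?nnegrE ?hnorm_ge0//.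
  by apply: prodr_ge0 => j _; exact: hnorm_ge0.
rewrite hnorm_sq (tens_inner htens) -prodrXl.
transitivity (Re_scalar (\prod_(j < s) `|x j| ^+ 2)).
  by congr Re_scalar; apply: eq_bigr => j _; rewrite inner_norm.
(* Nonnegativity is carried through the induction because [Re_scalar] is multiplicative only on
   nonnegative scalars. *)
suff [] : Re_scalar (\prod_(j < s) `|x j| ^+ 2) = \prod_(j < s) hnorm (x j) ^+ 2
          /\ 0 <= \prod_(j < s) `|x j| ^+ 2 by [].
elim/big_rec2: _ => [|j y1 y2 _ [<- y20]]; first by rewrite Re_scalar1 ler01.
rewrite mulr_ge0 ?exprn_ge0//; split => //.
by rewrite !Re_scalarM ?exprn_ge0// !expr2 Re_scalarM.
Qed.

(* The coordinates outside the orthonormal basis are replaced one at a time,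
   using continuity and linearity of [tens] in each of them. *)
Lemma tens_approximable x : approximable u (tens x).
Proof.
(* Induction on the number [t] of leading coordinates that are still arbitrary; for [t = s] the
   condition on [y] is vacuous. *)
suff: forall t (y : 'I_s -> H),
    (forall j : 'I_s, (t <= j)%N -> range e (y j)) -> approximable u (tens y).
  by move/(_ s); apply => j; rewrite leqNgt ltn_ord.
elim=> [|t IHt] y ye.
  have /choice[n ny] : forall j, exists i, e i = y j.
    by move=> j; have [//|i _ <-] := ye j; exists i.
  have -> : tens y = u [ffun j => n j].
    by congr tens; apply/funext => j; rewrite ffunE ny.
  exact: approximable_basis.
have [ts|st] := ltnP t s; last first.
  by apply: IHt => j tj; have := leq_trans st tj; rewrite leqNgt ltn_ord.
pose jt := Ordinal ts.
apply: approximable_lim => eta eta0.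
pose P := \prod_(j < s | j != jt) hnorm (y j).
have P0 : 0 <= P by apply: prodr_ge0 => j _; exact: hnorm_ge0.
(* [P] may vanish, so the tolerance is divided by [P + 1] instead. *)
have P1 : 0 < P + 1 by rewrite ltr_wpDl.
have [z [n [c [v [ve ->]]]] yz] :=
  dense_hnorm (y jt) he.2 (divr_gt0 eta0 P1).
exists (tens (put y jt (\sum_(i < n) c i *: v i))).
  rewrite tens_put_lcomb; apply: approximable_sum => i; apply: approximableZ.
  apply: IHt => j tj; rewrite /put; case: eqP => // jjt.
  apply: ye; rewrite ltn_neqAle tj andbT; apply/eqP => tjE; apply: jjt.
  exact/val_inj.
have -> : tens y = tens (put y jt (y jt)).
  by congr tens; apply/funext => j; rewrite /put; case: eqP => [->|].
rewrite -tens_putB hnorm_tens (bigD1 jt)//= {1}/put eqxx.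
rewrite (eq_bigr (fun j => hnorm (y j))); last first.
  by move=> j /negPf jjt; rewrite /put jjt.
apply: (@le_lt_trans _ _
  (hnorm (y jt - \sum_(i < n) c i *: v i) * (P + 1))).
  by rewrite ler_wpM2l ?hnorm_ge0// lerDl.
by rewrite -ltr_pdivlMr.
Qed.

Lemma tensor_basis_approximable f : approximable u f.
Proof.
apply: approximable_lim => eta eta0.
have [g [n [c [v [vt ->]]]] fg] := dense_hnorm f (tens_dense htens) eta0.
exists (\sum_(i < n) c i *: v i) => //.
apply: approximable_sum => i; apply: approximableZ.
by have [x _ <-] := vt i; exact: tens_approximable.
Qed.

End TensorBasis.

(** * Information complexity as a count of weights *)

Lemma sum_le_support (R : numDomainType) (I : eqType) (l l' : seq I)
    (F : I -> R) :
  uniq l -> uniq l' -> (forall i, 0 <= F i) ->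
  (forall i, i \notin l -> F i = 0) ->
  \sum_(i <- l') F i <= \sum_(i <- l) F i.
Proof.
move=> ul ul' F0 Fl; rewrite (bigID [in l])/= addrC big1 ?add0r//.
rewrite [leRHS](bigID [in l'])/=.
rewrite -[leLHS]big_filter -[X in _ <= X + _]big_filter.
rewrite (perm_big [seq i <- l | i \in l']) ?lerDl ?sumr_ge0//.
apply: uniq_perm; rewrite ?filter_uniq// => i.
by rewrite !mem_filter andbC.
Qed.

Section InformationComplexity.
Variables (R : realType) (k : scalar_kind) (H : hilbertSpace R k).
Variables (e : nat -> H) (he : orthonormal_basis e).
Variables (s : nat) (Hs : hilbertSpace R k) (tens : ('I_s -> H) -> Hs).
Hypothesis htens : is_hilbert_tensor_power tens.
Variables (omega : R) (m : nat -> nat) (a b : nat -> R).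
Local Notation K := (scalar_field R k).
Local Notation I := {ffun 'I_s -> nat}.
Local Notation u := (tensor_basis e tens).
Local Notation w := (@weight R omega m a b s).
Local Notation wspace := (wspace omega m a b e tens).
Local Notation wnorm_sq := (wnorm_sq omega m a b e tens).
Local Notation wnorm := (wnorm omega m a b e tens).
Local Notation info := (info_complexity omega m a b e tens).
Local Notation coef f n := (abs_scalar (inner Hs f (u n))).
Hypothesis weight_ge1 : forall n, 1 <= w n.

Let weight_ge0 n : 0 <= w n. Proof. exact: le_trans (weight_ge1 n). Qed.

Lemma wnorm_sq_le f B :
  (forall l : seq I, uniq l -> \sum_(n <- l) w n * coef f n ^+ 2 <= B) ->
  (wnorm_sq f <= B%:E)%E.
Proof.
move=> lB; apply: ge_ereal_sup => _ [A [finA _] <-].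
rewrite fsbig_finite//= sumEFin lee_fin.
exact/lB/finmap.fset_uniq.
Qed.

Lemma wnorm_sq_ge f (l : seq I) : uniq l ->
  ((\sum_(n <- l) w n * coef f n ^+ 2)%:E <= wnorm_sq f)%E.
Proof.
move=> ul; apply: esum_ge; exists [set` l].
  by split=> //; exact: finite_seq.
by rewrite -fsbig_seq//= -sumEFin.
Qed.

Lemma wnorm_sq_ge0 f : (0 <= wnorm_sq f)%E.
Proof. by have := @wnorm_sq_ge f [::]; rewrite big_nil; apply. Qed.

Lemma wspace_le f B :
  (forall l : seq I, uniq l -> \sum_(n <- l) w n * coef f n ^+ 2 <= B) ->
  wspace f.
Proof. by move=> /wnorm_sq_le fB; apply: le_lt_trans fB _; exact: ltry. Qed.

Lemma sum_le_wnorm f (l : seq I) : wspace f -> uniq l ->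
  \sum_(n <- l) w n * coef f n ^+ 2 <= wnorm f ^+ 2.
Proof.
move=> wf ul; rewrite sqr_sqrtr ?fine_ge0 ?wnorm_sq_ge0//.
rewrite -lee_fin fineK; first exact: wnorm_sq_ge.
by rewrite ge0_fin_numE ?wnorm_sq_ge0.
Qed.

Lemma wnorm_le1 f :
  (forall l : seq I, uniq l -> \sum_(n <- l) w n * coef f n ^+ 2 <= 1) ->
  wnorm f <= 1.
Proof.
move=> f1; rewrite -[leRHS]sqrtr1 ler_wsqrtr//.
rewrite -lee_fin fineK; first exact: wnorm_sq_le.
by rewrite ge0_fin_numE ?wnorm_sq_ge0//; exact: wspace_le f1.
Qed.

(** All weights are at least 1, so a single term of the weighted sum dominates the squared
    coefficient. This makes the coordinate functionals continuous for the weighted norm. *)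
Lemma coef_le_wnorm f n : wspace f -> coef f n <= wnorm f.
Proof.
move=> wf; rewrite -(@ler_pXn2r _ 2) ?nnegrE ?abs_scalar_ge0 ?sqrtr_ge0//.
have := @sum_le_wnorm f [:: n] wf isT; rewrite big_seq1; apply: le_trans.
by rewrite ler_peMl ?sqr_ge0.
Qed.

Lemma wspaceP c f g : wspace f -> wspace g -> wspace (c *: f + g).
Proof.
move=> wf wg.
(* The factors 2 come from (x + y)^2 <= 2 x^2 + 2 y^2, applied to each coefficient. *)
apply: (@wspace_le _
  (2 * abs_scalar c ^+ 2 * wnorm f ^+ 2 + 2 * wnorm g ^+ 2)) => l ul.
apply: le_trans (lerD (ler_wpM2l _ (sum_le_wnorm wf ul))
                      (ler_wpM2l _ (sum_le_wnorm wg ul))) => //; last first.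
  by rewrite mulr_ge0 ?sqr_ge0.
rewrite !mulr_sumr -big_split /=; apply: ler_sum => n _.
rewrite [X in _ <= X + _]mulrCA [X in _ <= _ + X]mulrCA -mulrDr ler_wpM2l//.
rewrite innerDl innerZl; set x := inner _ f _; set y := inner _ g _.
rewrite -mulrA -exprMn -abs_scalarM.
apply: (@le_trans _ _ ((abs_scalar (c * x) + abs_scalar y) ^+ 2)).
  by rewrite ler_pXn2r ?abs_scalarD ?nnegrE ?addr_ge0 ?abs_scalar_ge0.
by have := sqr_ge0 (abs_scalar (c * x) - abs_scalar y); lra.
Qed.

Lemma wspace0 : wspace 0.
Proof.
apply: (@wspace_le _ 0) => l _; rewrite big1// => n _.
by rewrite inner0l abs_scalar0 expr0n mulr0.
Qed.

Lemma wspaceB f g : wspace f -> wspace g -> wspace (f - g).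
Proof. by move=> wf wg; rewrite addrC -scaleN1r; exact: wspaceP. Qed.

Lemma wspace_basis n : wspace (u n).
Proof.
apply: (@wspace_le _ (\sum_(i <- [:: n]) w i * coef (u n) i ^+ 2)) => l ul.
apply: sum_le_support => // [i|i]; first by rewrite mulr_ge0 ?sqr_ge0.
rewrite inE => /negPf ni.
rewrite (tensor_basis_orthonormal he htens) eq_sym ni.
by rewrite abs_scalar0 expr0n mulr0.
Qed.

Lemma wspace_sum (l : seq I) (c : I -> K) : wspace (\sum_(n <- l) c n *: u n).
Proof.
elim/big_rec: _ => [|n x _ wx]; first exact: wspace0.
exact: wspaceP (wspace_basis n) wx.
Qed.

Lemma functional_sum (L : Hs -> K) (l : seq I) (c : I -> K) :
  cont_lin_functional omega m a b e tens L ->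
  L (\sum_(n <- l) c n *: u n) = \sum_(n <- l) c n * L (u n).
Proof.
case=> Llin _; elim: l => [|n l IHl].
  (* Linearity at zero reads [L 0 = L 0 + L 0], hence [L 0 = 0]. *)
  rewrite !big_nil; have /eqP := Llin 1 0 0 wspace0 wspace0.
  rewrite scale1r addr0 mul1r -subr_eq0 opprD addrA subrr add0r oppr_eq0.
  by move/eqP.
by rewrite !big_cons Llin ?IHl//; [exact: wspace_basis|exact: wspace_sum].
Qed.

Lemma inner_basis_continuous n :
  cont_lin_functional omega m a b e tens (fun f => inner Hs f (u n)).
Proof.
split=> [c f g _ _|f wf eps eps0]; first by rewrite innerDl innerZl.
exists eps => // g wg; apply: le_lt_trans; rewrite -innerBl.
exact/coef_le_wnorm/wspaceB.
Qed.

Lemma proj_linear_algorithm (l : seq I) :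
  linear_algorithm omega m a b e tens (size l) (proj u l).
Proof.
exists (fun j f => inner Hs f (u (tnth (in_tuple l) j))).
exists (fun j => u (tnth (in_tuple l) j)).
split=> [j|]; first exact: inner_basis_continuous.
by apply/funext => f; rewrite /proj [LHS]big_tnth.
Qed.

(** The squared residual is the sum of the squared coefficients outside [l], where each is at most
    [eps ^+ 2] times its weighted version. To stay with finite sums, [l] is enlarged to a list [l2]
    whose projection captures [f] up to [eta]; only the part [l1] of [l2] outside [l] then
    matters. *)
Lemma hnorm_sub_proj_le (l : seq I) f eps : uniq l -> 0 < eps -> wspace f ->
  wnorm f <= 1 -> (forall n, n \notin l -> eps ^- 2 <= w n) ->
  hnorm (f - proj u l f) <= eps.
Proof.
move=> ul eps0 wf f1 lw; have uo := tensor_basis_orthonormal he htens.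
rewrite -(@ler_pXn2r _ 2) ?nnegrE ?hnorm_ge0 ?(ltW eps0)//.
apply/ler_addgt0Pr => eta eta0.
have eta'0 : 0 < Num.sqrt eta by rewrite sqrtr_gt0.
have [l' ul' fl'] :=
  approximable_proj uo (tensor_basis_approximable he htens f) eta'0.
pose l2 := undup (l ++ l'); have ul2 : uniq l2 by exact: undup_uniq.
pose l1 := [seq n <- l2 | n \notin l].
have ul1 : uniq l1 by exact: filter_uniq.
have fl2 : hnorm (f - proj u l2 f) ^+ 2 <= eta.
  rewrite -(sqr_sqrtr (ltW eta0)) ler_pXn2r ?nnegrE ?hnorm_ge0 ?sqrtr_ge0//.
  apply: le_trans (ltW fl'); rewrite (proj_lcomb u l').
  apply: hnorm_proj_le => // n; rewrite -map_comp /= map_id mem_undup mem_cat.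
  by move=> ->; rewrite orbT.
(* Equating the Pythagoras decompositions of [f] along [l] and along [l2] expresses the residual of
   [l] through that of [l2]. *)
have /eqP := hnorm_proj_sq uo f ul.
rewrite (hnorm_proj_sq uo f ul2) eq_sym -subr_eq eq_sym => /eqP fl.
have l1_le : \sum_(n <- l1) coef f n ^+ 2 <= eps ^+ 2.
  rewrite -[leRHS]mulr1; apply: (@le_trans _ _ (eps ^+ 2 * wnorm f ^+ 2)).
    apply: le_trans (ler_wpM2l (sqr_ge0 _) (sum_le_wnorm wf ul1)).
    rewrite mulr_sumr big_seq [leRHS]big_seq; apply: ler_sum => n.
    rewrite mem_filter => /andP[/lw wn _]; rewrite mulrA ler_peMl ?sqr_ge0//.
    by rewrite -ler_pdivrMl ?exprn_gt0// mulr1.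
  by rewrite ler_wpM2l ?sqr_ge0// expr_le1 ?sqrtr_ge0.
have l2E : \sum_(n <- l2) coef f n ^+ 2 =
    \sum_(n <- l) coef f n ^+ 2 + \sum_(n <- l1) coef f n ^+ 2.
  rewrite -big_cat; apply: perm_big; apply: uniq_perm => //.
    rewrite cat_uniq ul ul1 andbT /=; apply/hasPn => n.
    by rewrite mem_filter => /andP[].
  move=> n; rewrite mem_undup !mem_cat mem_filter mem_undup mem_cat.
  by case: (n \in l).
move: fl; rewrite l2E; lra.
Qed.

Lemma info_complexity_le_size (l : seq I) eps : uniq l -> 0 < eps ->
  (forall n, n \notin l -> eps ^- 2 <= w n) ->
  (info eps <= (size l)%:R%:E)%E.
Proof.
move=> ul eps0 lw; apply: ereal_inf_lbound; exists (size l) => //=.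
apply: ereal_inf_le; exists (worst_case_error omega m a b e tens (proj u l)).
  by exists (proj u l) => //; exact: proj_linear_algorithm.
apply: ge_ereal_sup => _ [f [wf f1] <-]; rewrite lee_fin.
exact: hnorm_sub_proj_le.
Qed.

(** The bound [B] on the lengths yields a longest list of indices with weight below [eps ^- 2]. By
    maximality it contains all such indices, so projecting onto it suffices. *)
Lemma info_complexity_le (B eps : R) : 0 < eps ->
  (forall l : seq I, uniq l -> (forall n, n \in l -> w n < eps ^- 2) ->
     (size l)%:R <= B) ->
  (info eps <= B%:E)%E.
Proof.
move=> eps0 lB.
pose P n := `[< exists l : seq I,
  [/\ uniq l, forall n, n \in l -> w n < eps ^- 2 & size l = n] >].
have exP : exists n, P n by exists 0%N; apply/asboolP; exists [::].
have PB n : P n -> (n <= Num.truncn B)%N.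
  move=> /asboolP[l [ul lw <-]].
  by rewrite -ltnS -(ltr_nat R); apply: le_lt_trans (lB l ul lw) (truncnS_gt B).
case: (ex_maxnP exP PB) => _ /asboolP[l [ul lw <-]] lmax.
apply: (@le_trans _ _ (size l)%:R%:E); last by rewrite lee_fin lB.
apply: info_complexity_le_size => // n nl; rewrite leNgt; apply/negP => wn.
suff /lmax : P (size (n :: l)) by rewrite ltnn.
apply/asboolP; exists (n :: l); split; last by [].
  by rewrite cons_uniq nl.
by move=> n'; rewrite inE => /predU1P[->|]; [exact: wn|exact: lw].
Qed.

(* With fewer than [size l] functionals, some nonzero combination of the
   [u n], [n \in l], is annihilated by all of them. *)
Lemma minimal_error_ge (l : seq I) (delta : R) (N : nat) : uniq l ->
  0 <= delta -> (forall n, n \in l -> w n * delta ^+ 2 <= 1) ->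
  (N < size l)%N ->
  (delta%:E <= minimal_error omega m a b e tens N)%E.
Proof.
move=> ul delta0 lw Nl; have uo := tensor_basis_orthonormal he htens.
apply: le_ereal_inf_tmp => _ [A [L [g [Lc AE]] <-]].
pose v i := tnth (in_tuple l) i.
pose M := \matrix_(i < size l, j < N) L j (u (v i)).
(* [M] has more rows than columns, so its left kernel is nontrivial. *)
have /rowV0Pn[x xM x0] : kermx M != 0.
  rewrite kermx_eq0 /row_free; apply: contraTneq Nl => <-.
  by rewrite -leqNgt rank_leq_col.
(* The kernel vector is indexed by positions in [l]; [c] reads it as a function of multi-indices,
   with value 0 off [l]. *)
pose c n := if insub (index n l) is Some i then x 0 i else 0.
have cv i : c (v i) = x 0 i.
  rewrite /c /v (tnth_nth (v i)) index_uniq ?ltn_ord//.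
  case: insubP => [i' _ ii'|]; last by rewrite ltn_ord.
  by congr (x 0 _); exact: val_inj.
pose f := \sum_(n <- l) c n *: u n.
have Af y : A (y *: f) = 0.
  have -> : y *: f = \sum_(n <- l) (y * c n) *: u n.
    by rewrite scaler_sumr; apply: eq_bigr => n _; rewrite scalerA.
  rewrite AE big1// => j _; rewrite (functional_sum _ _ (Lc j)) big_tnth.
  move/sub_kermxP/matrixP/(_ 0 j): xM; rewrite !mxE => xMj.
  rewrite [X in X *: _](_ : _ = 0) ?scale0r// -[RHS](mulr0 y) -[in RHS]xMj.
  by rewrite mulr_sumr; apply: eq_bigr => i _; rewrite mxE -cv mulrA.
pose t := hnorm f.
have t0 : 0 < t.
  apply: hnorm_gt0; apply: contra_neq x0 => f0; apply/rowP => i.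
  rewrite mxE -cv; have := inner_lcomb uo c (v i) ul.
  have vl : v i \in l by exact: mem_tnth.
  by rewrite -/f f0 inner0l vl => <-.
(* The fooling element: [A] sends it to 0, so its error is its own norm, scaled to [delta]. *)
pose h := scalar_of k (delta / t) *: f.
have dt0 : 0 <= delta / t by apply: divr_ge0 => //; exact: ltW.
have hn : hnorm h = delta by rewrite hnormZ abs_scalar_of// -/t divfK// gt_eqF.
have hE : h = \sum_(n <- l) (scalar_of k (delta / t) * c n) *: u n.
  by rewrite /h scaler_sumr; apply: eq_bigr => n _; rewrite scalerA.
apply: ereal_sup_ubound; exists h; last by rewrite Af subr0 hn.
split; first by rewrite hE; exact: wspace_sum.
apply: wnorm_le1 => l' ul'.
apply: le_trans (sum_le_support ul ul' _ _) _ => [n|n nl|].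
- by rewrite mulr_ge0 ?sqr_ge0.
- by rewrite hE (inner_lcomb uo)// (negPf nl) abs_scalar0 expr0n mulr0.
have hsum : \sum_(n <- l) coef h n ^+ 2 = delta ^+ 2.
  rewrite -hn [in RHS]hE (hnorm_lcomb_sq uo)// big_seq [RHS]big_seq.
  by apply: eq_bigr => n nl; rewrite hE (inner_lcomb uo)// nl.
(* For [delta = 0] all coefficients of [h] vanish; otherwise the goal may be multiplied by
   [delta ^+ 2] and compared termwise with [hsum]. *)
have [d0|d0] := eqVneq delta 0.
  rewrite big1_seq// => n /= nl; move/eqP: hsum; rewrite d0 expr0n /=.
  rewrite psumr_eq0; last by move=> i _; exact: sqr_ge0.
  by move=> /allP/(_ n nl)/= /eqP ->; rewrite mulr0.
have d20 : 0 < delta ^+ 2 by rewrite exprn_gt0// lt_neqAle eq_sym d0.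
rewrite -(ler_pM2r d20) mul1r -[leRHS]hsum mulr_suml big_seq [leRHS]big_seq.
apply: ler_sum => n nl; rewrite mulrAC ler_piMl ?sqr_ge0//.
exact: lw.
Qed.

(** The strict gap between [eps] and [delta] matters: fewer than [size l] functionals leave an error
    of at least [delta], which then exceeds [eps]. *)
Lemma info_complexity_ge (l : seq I) (eps delta : R) : uniq l ->
  0 < eps < delta -> (forall n, n \in l -> w n * delta ^+ 2 <= 1) ->
  ((size l)%:R%:E <= info eps)%E.
Proof.
move=> ul /andP[eps0 epsd] lw; apply: le_ereal_inf_tmp => _ [N /= NE <-].
rewrite lee_fin ler_nat leqNgt; apply/negP => /(minimal_error_ge ul _ lw).
move=> /(_ (ltW (lt_trans eps0 epsd))) dN.
by have := le_trans dN NE; rewrite lee_fin leNgt epsd.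
Qed.

End InformationComplexity.
(** * Sums over blocks *)

Section Blocks.
Variable m : nat -> nat.
Hypothesis m_gt0 : forall i, (0 < m i)%N.

Lemma block_startS i : block_start m i.+1 = (block_start m i + m i)%N.
Proof. by rewrite /block_start big_ord_recr. Qed.

Lemma block_start_lt i j : (i < j)%N -> (block_start m i < block_start m j)%N.
Proof.
have step n : (block_start m n < block_start m n.+1)%N.
  by rewrite block_startS -[ltnLHS]addn0 ltn_add2l.
by move: i j; apply: (homo_ltn (@ltn_trans) step).
Qed.

Lemma block_ofP i :
  (block_start m (block_of m i) <= i < block_start m (block_of m i).+1)%N.
Proof.
rewrite /block_of.
apply: (@getPex _ [set j | (block_start m j <= i < block_start m j.+1)%N]).
elim: i => [|i [j /= /andP[ji ij]]].
  exists 0%N; rewrite /= block_startS /block_start big_ord0.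
  exact: m_gt0.
have [ij'|ij'] := ltnP i.+1 (block_start m j.+1).
  by exists j; rewrite /= ij' ltnW.
by exists j.+1; rewrite /= ij' (leq_ltn_trans ij)// block_start_lt.
Qed.

Lemma block_of_eq i j :
  (block_start m j <= i < block_start m j.+1)%N -> block_of m i = j.
Proof.
move=> /andP[ji ij]; have /andP[bi ib] := block_ofP i.
case: (ltngtP (block_of m i) j) => // [bj|jb].
  have : (block_start m (block_of m i).+1 <= block_start m j)%N.
    by move: bj; rewrite leq_eqVlt => /predU1P[->//|/block_start_lt/ltnW].
  by move=> /leq_trans/(_ ji); rewrite leqNgt ib.
have : (block_start m j.+1 <= block_start m (block_of m i))%N.
  by move: jb; rewrite leq_eqVlt => /predU1P[->//|/block_start_lt/ltnW].
by move=> /leq_trans/(_ bi); rewrite leqNgt ij.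
Qed.

Lemma block_start0 : block_start m 0 = 0%N.
Proof. by rewrite /block_start big_ord0. Qed.

Lemma block_of_lt i : (i < m 0)%N -> block_of m i = 0%N.
Proof. by move=> im; apply: block_of_eq; rewrite block_startS block_start0. Qed.

Lemma block_of_m0 : block_of m (m 0) = 1%N.
Proof.
apply: block_of_eq; rewrite !block_startS block_start0 add0n leqnn.
by rewrite -[ltnLHS]addn0 ltn_add2l m_gt0.
Qed.

Lemma block_of_gt0 i : (m 0 <= i)%N -> (0 < block_of m i)%N.
Proof.
move=> mi; rewrite lt0n; apply/eqP => bi; have /andP[_] := block_ofP i.
by rewrite bi block_startS block_start0 add0n ltnNge mi.
Qed.

(** Blocks have at most [M] elements, so the first [block_of m i + 1] of them cover at most that
    many times [M] indices. The block number thus grows at least linearly. *)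
Lemma lt_block_of M i : (forall j, (m j <= M)%N) ->
  (i < M * (block_of m i).+1)%N.
Proof.
move=> mM; have /andP[_ ib] := block_ofP i; apply: leq_trans ib _.
elim: (block_of m i).+1 => [|j IHj]; first by rewrite block_start0.
by rewrite block_startS mulnS addnC leq_add.
Qed.

End Blocks.

(** * Estimates for series, exponentials and sums of products *)

(** A discrete integral comparison: with [d = x - 1], each term after the first is at most the
    corresponding increment of - n^(-d) / d, and these telescope. *)
Lemma sum_powR_le (R : realType) (x : R) (N : nat) : 1 < x ->
  \sum_(i < N) i.+1%:R `^ (- x) <= 1 + (x - 1)^-1.
Proof.
move=> x1; pose d := x - 1; have d0 : 0 < d by rewrite subr_gt0.
have H n :
    \sum_(i < n.+1) i.+1%:R `^ (- x) <= 1 + d^-1 * (1 - n.+1%:R `^ (- d)).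
  elim: n => [|n IHn]; first by rewrite big_ord1 !powR1 subrr mulr0 addr0.
  rewrite big_ord_recr /=.
  suff : n.+2%:R `^ (- x) <= d^-1 * (n.+1%:R `^ (- d) - n.+2%:R `^ (- d)).
    by move: IHn; rewrite !mulrBr; lra.
  rewrite ler_pdivlMl// /powR !pnatr_eq0 /=.
  set A := ln n.+1%:R; set B := ln n.+2%:R.
  have AB : n.+2%:R^-1 <= B - A.
    have := @le_ln1Dx R (- n.+2%:R^-1).
    rewrite ltrN2 invf_lt1// ltr1n => /(_ isT).
    have -> : 1 + - n.+2%:R^-1 = n.+1%:R / n.+2%:R :> R.
      have -> : n.+1%:R = n.+2%:R - 1 :> R by rewrite -[n.+2%:R]natr1 addrK.
      by rewrite mulrBl divff ?pnatr_eq0// mul1r.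
    by rewrite ln_div ?posrE// -/A -/B lerNr opprB.
  have -> : - x * B = - d * B + - B by rewrite /d; ring.
  rewrite expRD [expR (- B)]expRN /B lnK ?posrE// -/B.
  have -> : - d * A = - d * B + d * (B - A) by ring.
  rewrite expRD -[X in _ <= _ - X]mulr1 -mulrBr mulrCA ler_wpM2l ?expR_ge0//.
  apply: (@le_trans _ _ (d * (B - A))); first by rewrite ler_pM2l.
  by have := expR_ge1Dx (d * (B - A)); lra.
case: N => [|n]; first by rewrite big_ord0 addr_ge0 ?invr_ge0 ?(ltW d0).
by apply: le_trans (H n) _; rewrite lerD2l ler_piMr ?invr_ge0 ?(ltW d0)// gerBl.
Qed.

(** A single term of the exponential series is enough: its degree [n.+1] exceeds 2 / beta, so the
    power of i^beta in it dominates i^2. *)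
Lemma expR_powR_le (R : realType) (c beta : R) : 0 < c -> 0 < beta ->
  exists2 D : R, 0 < D & forall i : nat, (0 < i)%N ->
    expR (- (c * i%:R `^ beta)) <= D * i%:R ^- 2.
Proof.
move=> c0 beta0; pose n := Num.truncn (2 / beta).
exists (n.+1`!%:R / c ^+ n.+1).
  by rewrite divr_gt0 ?exprn_gt0// ltr0n fact_gt0.
move=> i i0; have i0' : 0 < i%:R :> R by rewrite ltr0n.
have y0 : 0 <= c * i%:R `^ beta by rewrite mulr_ge0 ?powR_ge0 ?ltW.
have := expR_ge1Dxn n y0; move=> /(le_trans _) expy.
have {expy} : (c * i%:R `^ beta) ^+ n.+1 / n.+1`!%:R <= expR (c * i%:R `^ beta).
  by apply: expy; rewrite lerDr.
have : i%:R ^+ 2 <= (i%:R `^ beta) ^+ n.+1.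
  rewrite -!powR_mulrn ?powR_ge0 ?ler0n// -powRrM ler_powR ?ler1n//.
  by rewrite mulrC -ler_pdivrMr// ltW// truncnS_gt.
rewrite exprMn expRN => i2 expy.
rewrite -[n.+1`!%:R / _]invf_div -invfM lef_pV2 ?posrE ?expR_gt0//.
  apply: le_trans expy; rewrite [leRHS]mulrAC ler_wpM2l//.
  by rewrite divr_ge0 ?exprn_ge0 ?ltW.
by rewrite mulr_gt0 ?exprn_gt0// divr_gt0 ?exprn_gt0// ltr0n fact_gt0.
Qed.

(** The list is enlarged to a full box, over which the sum of products factorizes. *)
Lemma sum_prod_le (R : numDomainType) (s : nat) (F : 'I_s -> nat -> R)
    (B : 'I_s -> R) (l : seq {ffun 'I_s -> nat}) :
  (forall j i, 0 <= F j i) -> (forall j N, \sum_(i < N) F j i <= B j) ->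
  uniq l -> \sum_(n <- l) \prod_(j < s) F j (n j) <= \prod_(j < s) B j.
Proof.
move=> F0 FB ul; pose N := (\max_(n <- l) \max_(j < s) n j)%N.+1.
have nN (n : {ffun 'I_s -> nat}) j : n \in l -> (n j < N)%N.
  move=> nl; rewrite ltnS; apply: (leq_trans (leq_bigmax j)).
  exact: leq_bigmax_seq nl isT.
pose emb (g : {ffun 'I_s -> 'I_N}) : {ffun 'I_s -> nat} :=
  [ffun j => val (g j)].
have embI : injective emb.
  move=> g h /ffunP gh; apply/ffunP => j; apply: val_inj.
  by have := gh j; rewrite !ffunE.
pose l' := [seq emb g | g <- enum {ffun 'I_s -> 'I_N}].
have ul' : uniq l' by rewrite map_inj_uniq ?enum_uniq.
have ll' : {subset l <= l'}.
  move=> n nl; apply/mapP; exists [ffun j => Ordinal (nN n j nl)].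
    by rewrite mem_enum.
  by apply/ffunP => j; rewrite !ffunE.
pose G n := if n \in l' then \prod_(j < s) F j (n j) else 0.
have P0 n : 0 <= \prod_(j < s) F j (n j) by apply: prodr_ge0.
rewrite (eq_big_seq G); last by move=> n /ll' nl'; rewrite /G nl'.
apply: le_trans (sum_le_support ul' ul _ _) _.
- by move=> n; rewrite /G; case: ifP.
- by move=> n /negPf nl'; rewrite /G nl'.
pose P (n : {ffun 'I_s -> nat}) := \prod_(j < s) F j (n j).
rewrite (eq_big_seq P); last first.
  by move=> n nl'; rewrite /G nl'.
rewrite big_map big_enum /= /P.
under eq_bigr do under eq_bigr do rewrite ffunE.
rewrite -(bigA_distr_bigA (fun j (i : 'I_N) => F j i)).
by apply: ler_prod => j _; rewrite sumr_ge0 ?FB.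
Qed.

(** * Uniform bounds on sums of weights *)

Section Tractability.
Variables (R : realType) (omega : R) (m : nat -> nat) (a b : nat -> R).
Hypothesis omega01 : 0 < omega < 1.
Hypothesis m_gt0 : forall i, (0 < m i)%N.
Hypothesis a_gt0 : forall j, (0 < j)%N -> 0 < a j.
Hypothesis a_ndecr : forall i j, (0 < i)%N -> (i <= j)%N -> a i <= a j.
Hypothesis b_gt0 : forall j, (0 < j)%N -> 0 < b j.
Local Notation L := (ln omega^-1).

Let omega_gt0 : 0 < omega. Proof. by case/andP: omega01. Qed.

Lemma ln_inv_gt0 : 0 < L.
Proof. by case/andP: omega01 => o0 o1; rewrite ln_gt0// invf_gt1. Qed.

Lemma omega_powR x : omega `^ x = expR (- (L * x)).
Proof. by rewrite /powR gt_eqF// lnV ?posrE// mulNr opprK mulrC. Qed.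

Lemma weight_expR s (n : {ffun 'I_s -> nat}) :
  weight omega m a b n =
  expR (L * \sum_(j < s) a j.+1 * (block_of m (n j))%:R `^ b j.+1).
Proof. by rewrite /weight omega_powR mulrN opprK. Qed.

Lemma weight_ge1 s (n : {ffun 'I_s -> nat}) : 1 <= weight omega m a b n.
Proof.
rewrite weight_expR -expR0 ler_expR mulr_ge0 ?(ltW ln_inv_gt0)//.
by apply: sumr_ge0 => j _; rewrite mulr_ge0 ?powR_ge0// ltW// a_gt0.
Qed.

Section Upper.
Hypothesis m_bounded : exists M, forall i, (m i <= M)%N.
Hypothesis b_inf : 0 < inf [set b j | j in [set j : nat | (0 < j)%N]].
Hypothesis m0 : m 0 = 1%N.

(** The point is that [B] is independent of [j]. Block 0 is the single index 0 and contributes 1. On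
    a block q >= 1, monotonicity of [a] and b_j >= beta give a_j q^(b_j) >= a_j + a_1 (q^beta - 1),
    which splits off the factor depending on [j]. *)
Lemma factor_le tau : 0 < tau ->
  exists2 B : R, 0 <= B & forall j N, (0 < j)%N ->
  \sum_(i < N) expR (- (L * tau * (a j * (block_of m i)%:R `^ b j)))
  <= 1 + B * expR (- (L * tau * a j)).
Proof.
move=> tau0; have [M mM] := m_bounded.
pose beta := inf [set b j | j in [set j : nat | (0 < j)%N]].
have Lt0 : 0 < L * tau by rewrite mulr_gt0 ?ln_inv_gt0.
pose c := L * tau * a 1; have c0 : 0 < c by rewrite mulr_gt0 ?a_gt0.
have [D D0 HD] := expR_powR_le c0 b_inf.
have M0 : (0 < M)%N by apply: leq_trans (mM 0%N); rewrite m0.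
(* The factor [expR c] comes from the shift by - a_1, [D] from replacing the exponential by q^(-2),
   [(2 * M%:R) ^+ 2] from i + 1 <= 2 M q, and the last factor bounds the sum of (i + 1)^(-2). *)
pose B := expR c * D * (2 * M%:R) ^+ 2 * (1 + (2 - 1)^-1).
have B0 : 0 <= B by rewrite !mulr_ge0 ?expR_ge0 ?sqr_ge0 ?(ltW D0)//; lra.
exists B => //.
move=> j N j0.
have bj : beta <= b j.
  apply: ge_inf; last by exists j.
  by exists 0 => _ [i /= i0 <-]; exact/ltW/b_gt0.
case: N => [|N].
  by rewrite big_ord0 addr_ge0// mulr_ge0 ?expR_ge0.
rewrite big_ord_recl /= block_of_lt ?m0// powR0 ?gt_eqF ?b_gt0//.
rewrite !mulr0 oppr0 expR0 lerD2l.
have term (i : nat) :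
    expR (- (L * tau * (a j * (block_of m i.+1)%:R `^ b j))) <=
    expR c * D * (2 * M%:R) ^+ 2 * expR (- (L * tau * a j)) * i.+1%:R `^ (- 2).
  set q := block_of m i.+1.
  have q1 : (0 < q)%N by apply: block_of_gt0; rewrite ?m0.
  have q1r : 1 <= q%:R :> R by rewrite ler1n.
  have qb : q%:R `^ beta <= q%:R `^ b j by rewrite ler_powR.
  have qb1 : 1 <= q%:R `^ beta.
    by rewrite -[leLHS](powRr0 (q%:R : R)) ler_powR// ltW.
  have aj1 : a 1 <= a j by rewrite a_ndecr.
  have step1 : expR (- (L * tau * (a j * q%:R `^ b j))) <=
      expR c * expR (- (L * tau * a j)) * expR (- (c * q%:R `^ beta)).
    rewrite -!expRD ler_expR.
    have : 0 <= L * tau * (a j * (q%:R `^ b j - q%:R `^ beta)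
                    + (a j - a 1) * (q%:R `^ beta - 1)).
      apply: mulr_ge0; first exact: ltW.
      by rewrite addr_ge0// mulr_ge0 ?subr_ge0// ltW// a_gt0.
    rewrite /c; lra.
  apply: le_trans step1 _.
  have step2 :
      expR (- (c * q%:R `^ beta)) <= D * (2 * M%:R) ^+ 2 * i.+1%:R ^- 2.
    apply: le_trans (HD _ q1) _; rewrite -mulrA ler_wpM2l ?(ltW D0)//.
    rewrite -expr_div_n -exprVn.
    rewrite ler_pXn2r ?nnegrE ?invr_ge0 ?divr_ge0 ?mulr_ge0//.
    rewrite ler_pdivlMr ?ltr0n// mulrC ler_pdivrMr ?ltr0n//.
    rewrite -mulrA -!natrM ler_nat.
    apply: leq_trans (ltnW (lt_block_of m_gt0 i.+1 mM)) _.
    by rewrite mulnCA leq_mul2l -/q mul2n -addnn -addn1 leq_add2l q1 orbT.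
  rewrite powR_invn ?ler0n//.
  apply: le_trans (ler_wpM2l _ step2) _; first by rewrite mulr_ge0 ?expR_ge0.
  by rewrite le_eqVlt; apply/orP; left; apply/eqP; ring.
apply: (@le_trans _ _ (\sum_(i < N) expR c * D * (2 * M%:R) ^+ 2 *
    expR (- (L * tau * a j)) * i.+1%:R `^ (- 2))).
  by apply: ler_sum => i _; exact: term.
rewrite -mulr_sumr /B [leRHS]mulrAC ler_wpM2l//.
  by rewrite !mulr_ge0 ?expR_ge0 ?sqr_ge0 ?(ltW D0).
by apply: sum_powR_le; rewrite ltr1n.
Qed.

(** The terms with [j < j0] are at most 1 each; the later ones are at most (j + 1)^(-x) with x = L
    tau r > 1. *)
Lemma sum_expR_le tau r (j0 : nat) : 0 < tau -> 1 < L * tau * r ->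
  (forall j, (j0 <= j)%N -> r * ln j%:R <= a j) ->
  exists C : R, forall s : nat, \sum_(j < s) expR (- (L * tau * a j.+1)) <= C.
Proof.
move=> tau0 x1 ar; pose x := L * tau * r.
have Lt0 : 0 < L * tau by rewrite mulr_gt0 ?ln_inv_gt0.
exists (j0%:R + (1 + (x - 1)^-1)) => s.
pose F (j : nat) := expR (- (L * tau * a j.+1)).
have F1 j : F j <= 1.
  by rewrite expR_le1 oppr_le0 mulr_ge0 ?(ltW Lt0)// ltW// a_gt0.
apply: (@le_trans _ _ (\sum_(j < s) ((j < j0)%N%:R + j.+1%:R `^ (- x)))).
  apply: ler_sum => j _; have [jj0|j0j] := ltnP j j0.
    by apply: le_trans (F1 j) _; rewrite lerDl powR_ge0.
  rewrite add0r /powR pnatr_eq0 /= ler_expR mulNr lerN2 /x -[leLHS]mulrA.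
  rewrite ler_pM2l//; apply: ar; exact: leqW.
rewrite big_split /= lerD ?sum_powR_le//.
rewrite -natr_sum ler_nat.
suff -> : (\sum_(j < s) (j < j0) = minn s j0)%N by exact: geq_minr.
elim: s => [|s IHs]; first by rewrite big_ord0 min0n.
rewrite big_ord_recr /= IHs; have [sj|js] := ltnP s j0.
  by rewrite (minn_idPl sj) addn1.
by rewrite (minn_idPr (leqW js)) addn0.
Qed.

(** After factorization, 1 + y <= e^y turns the product over coordinates into the exponential of a
    sum bounded uniformly in [s]. *)
Lemma sum_weight_le tau r (j0 : nat) : 0 < tau -> 1 < L * tau * r ->
  (forall j, (j0 <= j)%N -> r * ln j%:R <= a j) ->
  exists2 C : R, 0 < C & forall s (l : seq {ffun 'I_s -> nat}), uniq l ->
    \sum_(n <- l) weight omega m a b n `^ (- tau) <= C.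
Proof.
move=> tau0 x1 ar.
have [B B0 HB] := factor_le tau0; have [C HC] := sum_expR_le tau0 x1 ar.
exists (expR (B * C)); first exact: expR_gt0.
move=> s l ul.
pose F (j : 'I_s) (i : nat) :=
  expR (- (L * tau * (a j.+1 * (block_of m i)%:R `^ b j.+1))).
have wF n : weight omega m a b n `^ (- tau) = \prod_(j < s) F j (n j).
  rewrite weight_expR -expRM -expR_sum; congr expR.
  rewrite mulrN mulrAC mulr_sumr -sumrN.
  by apply: eq_bigr => j _; rewrite mulrA.
under eq_bigr do rewrite wF.
have FB j N : \sum_(i < N) F j i <= 1 + B * expR (- (L * tau * a j.+1)).
  exact: HB.
apply: le_trans (sum_prod_le _ FB ul) _ => [j i|]; first exact: expR_ge0.
apply: (@le_trans _ _ (expR (B * \sum_(j < s) expR (- (L * tau * a j.+1))))).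
  rewrite mulr_sumr expR_sum; apply: ler_prod => j _.
  by rewrite expR_ge1Dx andbT addr_ge0// mulr_ge0 ?expR_ge0.
by rewrite ler_expR ler_wpM2l.
Qed.

End Upper.
End Tractability.
(** * Admissible exponents *)

Lemma powR_exponent_le (R : realType) (x y K : R) (s0 : nat) :
  (forall s : nat, (s0 <= s)%N -> (0 < s)%N -> s%:R `^ x <= K * s%:R `^ y) ->
  x <= y.
Proof.
move=> H; rewrite leNgt; apply/negP => yx.
pose th := x - y; have th0 : 0 < th by rewrite subr_gt0.
(* The sign of [K] is unknown; a positive constant is needed to extract a root of order [th]. *)
pose K' := Num.max K 1; have K'0 : 0 < K' by rewrite lt_max ltr01 orbT.
pose s := maxn s0 (Num.truncn (K' `^ th^-1)).+1.
have s_gt0 : (0 < s)%N by rewrite leq_max orbT.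
have sK : K' < s%:R `^ th.
  have <- : (K' `^ th^-1) `^ th = K'.
    by rewrite -powRrM mulVf ?gt_eqF// powRr1 ?ltW.
  apply: gt0_ltr_powR; rewrite ?nnegrE ?powR_ge0//.
  apply: lt_le_trans (truncnS_gt _) _.
  by rewrite ler_nat leq_maxr.
have := H s (leq_maxl _ _) s_gt0; rewrite leNgt => /negP; apply.
apply: (@le_lt_trans _ _ (K' * s%:R `^ y)).
  by rewrite ler_wpM2r ?powR_ge0// le_max lexx.
have -> : x = th + y by rewrite /th subrK.
rewrite powRD; last by apply/implyP => _; rewrite pnatr_eq0 -lt0n.
by rewrite ltr_pM2r// powR_gt0// ltr0n.
Qed.

Lemma subn_exp_le_ffact n d : ((n - d) ^ d <= n ^_ d)%N.
Proof.
suff H j : (j <= d)%N -> ((n - d) ^ j <= n ^_ j)%N by exact: H.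
elim: j => [|j IHj] jd; first by rewrite ffactn0.
rewrite expnSr ffactnSr.
by apply: leq_mul; [exact/IHj/ltnW|exact/leq_sub2l/ltnW].
Qed.

(** Each of the [d] factors of the falling factorial is at least s - d >= s / 2. *)
Lemma exp_le_bin s d : (2 * d <= s)%N -> (s ^ d <= 2 ^ d * d`! * 'C(s, d))%N.
Proof.
move=> ds; rewrite -mulnA [(d`! * _)%N]mulnC bin_ffact.
apply: leq_trans (leq_mul (leqnn _) (subn_exp_le_ffact s d)).
rewrite -expnMn; case: d ds => [//|d] ds; rewrite leq_exp2r//.
lia.
Qed.

Section Exponents.
Variables (R : realType) (k : scalar_kind).
Variables (H : hilbertSpace R k) (e : nat -> H).
Variables (Hs : nat -> hilbertSpace R k).
Variables (tens : forall s : nat, ('I_s -> H) -> Hs s).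
Arguments tens : clear implicits.
Variables (omega : R) (m : nat -> nat) (a b : nat -> R).
Hypothesis he : orthonormal_basis e.
Hypothesis htens :
  forall s : nat, (0 < s)%N -> is_hilbert_tensor_power (tens s).
Hypothesis omega01 : 0 < omega < 1.
Hypothesis m_gt0 : forall i, (0 < m i)%N.
Hypothesis a_gt0 : forall j, (0 < j)%N -> 0 < a j.
Hypothesis b_gt0 : forall j, (0 < j)%N -> 0 < b j.
Local Notation L := (ln omega^-1).
Local Notation N := (fun s : nat => info_complexity omega m a b e (tens s)).

Let w_ge1 := @weight_ge1 R omega m a b omega01 a_gt0.

Lemma SPT_exponents_gt (p r : R) (j0 : nat) :
  (forall i j, (0 < i)%N -> (i <= j)%N -> a i <= a j) ->
  (exists M, forall i, (m i <= M)%N) ->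
  0 < inf [set b j | j in [set j : nat | (0 < j)%N]] -> m 0 = 1%N ->
  0 < p -> 1 < L * (p / 2) * r ->
  (forall j, (j0 <= j)%N -> r * ln j%:R <= a j) ->
  SPT_exponents N p.
Proof.
move=> a_ndecr m_bounded b_inf m0 p0 pr ar; split=> //.
have tau0 : 0 < p / 2 by rewrite divr_gt0.
have [C C0 HC] :=
  sum_weight_le omega01 m_gt0 a_gt0 a_ndecr b_gt0 m_bounded b_inf m0 tau0 pr ar.
exists C => // s eps s0 /andP[eps0 _].
rewrite powRr0 mulr1.
apply: (info_complexity_le he (htens s0) (@w_ge1 s)) => // l ul lw.
(* Markov's inequality: every index of [l] contributes at least 1 to eps^(-p) times the sum of the
   weights to the power - p / 2. *)
apply: le_trans (ler_wpM2r (powR_ge0 _ _) (HC s l ul)).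
rewrite -sum1_size natr_sum mulr_suml big_seq [leRHS]big_seq.
apply: ler_sum => n /lw wn.
have w0 : 0 < weight omega m a b n by rewrite (lt_le_trans _ (w_ge1 n)).
have epsE : eps `^ (- p) = (eps ^- 2) `^ (p / 2).
  by rewrite -powR_invn ?(ltW eps0)// -powRrM; congr (_ `^ _); field.
have wp : weight omega m a b n `^ (p / 2) <= eps `^ (- p).
  rewrite epsE ge0_ler_powR ?nnegrE ?(ltW tau0) ?(ltW wn) ?(ltW w0)//.
  by rewrite invr_ge0 sqr_ge0.
have : (1 : R) <= eps `^ (- p) / weight omega m a b n `^ (p / 2).
  by rewrite ler_pdivlMr ?mul1r//; exact: powR_gt0.
by rewrite -powRN mulrC.
Qed.

(** Each [d]-element set of coordinates gives the multi-index equal to [v] on it and 0 elsewhere. As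
    [A] bounds the cost of one coordinate, these weights are at most e^(L d A), which is
    [delta ^- 2]. *)
Lemma bin_le_bound (v s d : nat) (A C p q : R) :
  tractability_bound N C p q -> (0 < v)%N -> (0 < s)%N -> 0 <= A ->
  (forall j : 'I_s, a j.+1 * (block_of m v)%:R `^ b j.+1 <= A) ->
  'C(s, d)%:R <= C * s%:R `^ q * (expR (- (L * (d%:R * A) / 2)) / 2) `^ (- p).
Proof.
move=> bound v0 s0 A0 aA.
pose delta := expR (- (L * (d%:R * A) / 2)); rewrite -/delta.
have delta0 : 0 < delta := expR_gt0 _.
have L0 := ln_inv_gt0 omega01.
have delta1 : delta <= 1.
  by rewrite expR_le1 oppr_le0 divr_ge0// !mulr_ge0// ltW.
pose ind (X : {set 'I_s}) := [ffun j => if j \in X then v else 0%N].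
have indI : injective ind.
  move=> X Y /ffunP XY; apply/setP => j; have := XY j; rewrite !ffunE.
  case: (j \in X); case: (j \in Y) => // /eqP.
    by rewrite gtn_eqF.
  by rewrite eq_sym gtn_eqF.
pose l := [seq ind X | X <- enum [set X : {set 'I_s} | #|X| == d]%SET].
have ul : uniq l by rewrite map_inj_uniq ?enum_uniq.
have szl : size l = 'C(s, d) by rewrite size_map -cardE card_draws card_ord.
rewrite -szl -lee_fin.
(* [delta] may equal 1, and the lower bound needs an accuracy strictly below it; halving meets both
   constraints. *)
have eps01 : 0 < delta / 2 < 1.
  by rewrite divr_gt0//= ltr_pdivrMr// mul1r (le_lt_trans delta1)// ltr1n.
apply: le_trans (bound s (delta / 2) s0 eps01).
have epsd : 0 < delta / 2 < delta.
  by rewrite divr_gt0//= ltr_pdivrMr// ltr_pMr// ltr1n.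
apply: (info_complexity_ge he (htens s0) (@w_ge1 s) ul epsd) => n /mapP[X].
rewrite mem_enum inE => /eqP Xd ->.
rewrite weight_expR// -expRM_natl -expRD expR_le1.
have : \sum_(j < s) a j.+1 * (block_of m (ind X j))%:R `^ b j.+1 <= d%:R * A.
  rewrite (bigID [in X])/= [X in _ + X]big1 ?addr0; last first.
    move=> j /negPf jX.
    by rewrite ffunE jX block_of_lt// powR0 ?mulr0// gt_eqF// b_gt0.
  apply: (@le_trans _ _ (\sum_(j < s | j \in X) A)).
    by apply: ler_sum => j jX; rewrite ffunE jX.
  by rewrite sumr_const Xd mulr_natl.
move=> /(ler_wpM2l (ltW L0)); lra.
Qed.

(** The common core of both lower bounds. For A(s) <= r ln s the accuracy is a power of [s] up to a
    constant, so the bound on C(s, d) compares two powers of [s]. *)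
Lemma le_exponent (v d j0 : nat) (A : nat -> R) (C p q r : R) :
  tractability_bound N C p q -> (0 < v)%N ->
  (forall s, (0 < s)%N -> 0 <= A s) ->
  (forall s (j : 'I_s), a j.+1 * (block_of m v)%:R `^ b j.+1 <= A s) ->
  0 < C -> 0 < p ->
  (forall s, (j0 <= s)%N -> A s <= r * ln s%:R) ->
  d%:R <= q + p / 2 * (L * (d%:R * r)).
Proof.
move=> bound v0 A0 aA C0 p0 Ar.
have L0 := ln_inv_gt0 omega01.
(* The constants of [exp_le_bin], of the tractability bound and of the halved accuracy. *)
pose K := (2 ^ d * d`!)%:R * (C * 2 `^ p).
apply: (@powR_exponent_le _ _ _ K (maxn j0 (2 * d))) => s.
rewrite geq_max => /andP[js ds] s0.
have s0' : s%:R != 0 :> R by rewrite pnatr_eq0 -lt0n.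
rewrite powR_mulrn ?ler0n// -natrX.
apply: (@le_trans _ _ ((2 ^ d * d`!)%:R * 'C(s, d)%:R)).
  by rewrite -natrM ler_nat exp_le_bin.
rewrite /K -mulrA ler_wpM2l ?ler0n//.
apply: le_trans (bin_le_bound d bound v0 s0 (A0 s s0) (@aA s)) _.
have -> : (expR (- (L * (d%:R * A s) / 2)) / 2) `^ (- p) =
    2 `^ p * expR (p / 2 * (L * (d%:R * A s))).
  rewrite powRM ?expR_ge0 ?invr_ge0// mulrC [2^-1 `^ _](_ : _ = 2 `^ p).
    by rewrite -expRM; congr (_ * expR _); field.
  by rewrite -powR_inv1// -powRrM mulrNN mul1r.
rewrite powRD ?s0' ?implybT//.
rewrite [leRHS]mulrA [leLHS]mulrA.
rewrite ler_pM ?mulr_ge0 ?powR_ge0 ?expR_ge0 ?(ltW C0)//.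
  by rewrite mulrAC.
rewrite /powR (negPf s0') ler_expR.
have := Ar s js.
have : 0 <= p / 2 * (L * d%:R) by rewrite !mulr_ge0 ?(ltW p0) ?(ltW L0).
by move=> /ler_wpM2l H1 /H1; lra.
Qed.

End Exponents.

(** * Comparison of the sequence [a] with the logarithm *)

Section LogarithmicGrowth.
Variables (R : realType) (a : nat -> R) (alpha : \bar R).
Hypothesis alphaP : (fun j : nat => (a j / ln j%:R)%:E) @ \oo --> alpha.

Lemma ge_ln_near (r : R) : (r%:E < alpha)%E ->
  exists j0 : nat, forall j, (j0 <= j)%N -> r * ln j%:R <= a j.
Proof.
move=> ra; have [j0 _ H] := alphaP (open_ereal_gt' ra).
(* From 2 on the logarithm is positive and the quotient can be cleared. *)
exists (maxn j0 2) => j; rewrite geq_max => /andP[/H/= + j2].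
by rewrite lte_fin ltr_pdivlMr => [/ltW //|]; rewrite ln_gt0// ltr1n.
Qed.

Lemma le_ln_near (r : R) : (alpha < r%:E)%E ->
  exists j0 : nat, forall j, (j0 <= j)%N -> a j <= r * ln j%:R.
Proof.
move=> ra; have [j0 _ H] := alphaP (open_ereal_lt' ra).
exists (maxn j0 2) => j; rewrite geq_max => /andP[/H/= + j2].
by rewrite lte_fin ltr_pdivrMr => [/ltW //|]; rewrite ln_gt0// ltr1n.
Qed.

End LogarithmicGrowth.

(** * Equivalence of the three conditions and value of the exponent *)

Theorem theorem5 (R : realType) (k : scalar_kind)
  (H : hilbertSpace R k) (e : nat -> H)
  (Hs : nat -> hilbertSpace R k) (tens : forall s : nat, ('I_s -> H) -> Hs s)
  (omega : R) (m : nat -> nat) (a b : nat -> R) (alpha : \bar R)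
  (he : orthonormal_basis e)
  (htens : forall s : nat, (0 < s)%N -> is_hilbert_tensor_power (tens s))
  (homega : 0 < omega < 1)
  (hm_pos : forall i : nat, (0 < m i)%N)
  (hm_bounded : exists M : nat, forall i : nat, (m i <= M)%N)
  (ha_pos : forall j : nat, (0 < j)%N -> 0 < a j)
  (ha_nondecreasing : forall i j : nat, (0 < i)%N -> (i <= j)%N -> a i <= a j)
  (hb_pos : forall j : nat, (0 < j)%N -> 0 < b j)
  (hb_inf : 0 < inf [set b j | j in [set j : nat | (0 < j)%N]])
  (halpha_ge0 : (0 <= alpha)%E)
  (halpha : (fun j : nat => (a j / ln j%:R)%:E) @ \oo --> alpha) :
  let N := fun s : nat => info_complexity omega m a b e (tens s) in
  [/\ SPT N <-> PT N,
      PT N <-> m 0%N = 1%N /\ (0 < alpha)%E &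
      SPT N ->
        SPT_exponent N =
          match alpha with
          | r%:E => 2 / (r * ln omega^-1)
          | _ => 0 (* alpha = +oo *)
          end].
Proof.
move=> N; set L := ln omega^-1.
have L0 : 0 < L by exact: ln_inv_gt0.
have A0 s : (0 < s)%N -> 0 <= a s by move=> /ha_pos/ltW.
have Am0 s (j : 'I_s) : a j.+1 * (block_of m (m 0))%:R `^ b j.+1 <= a s.
  by rewrite block_of_m0// powR1 mulr1; apply: ha_nondecreasing.
have SPT_PT : SPT N -> PT N.
  by move=> [p [p0 [C C0 HC]]]; exists C, p, 0.
have PT_m0 : PT N -> m 0 = 1%N.
  move=> [C [p [q [C0 p0 q0 bound]]]]; apply/eqP; rewrite eqn_leq hm_pos andbT.
  rewrite leqNgt; apply/negP => m1.
  (* If block 0 contains the index 1, this coordinate value costs nothing: [A] and [r] are 0, and d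
     <= q fails for the first integer above [q]. *)
  have := le_exponent he htens homega hm_pos ha_pos hb_pos (v := 1%N)
    (j0 := 0%N) (A := fun=> 0) (r := 0) (Num.truncn q).+1 bound
    isT (fun _ _ => lexx _) _ C0 p0 _.
  rewrite !mulr0 addr0 leNgt truncnS_gt => absurd_bound; suff : false by [].
  apply: absurd_bound => [s j|s _]; last by rewrite mul0r.
  by rewrite block_of_lt// powR0 ?mulr0// gt_eqF// hb_pos.
(* Here [v] is [m 0], in block 1, so coordinate j costs a_j <= a_s. *)
have PT_lb C p q d r : 0 < C -> 0 < p -> tractability_bound N C p q ->
    (alpha < r%:E)%E -> d%:R <= q + p / 2 * (L * (d%:R * r)).
  move=> C0 p0 bound /(le_ln_near halpha)[j0 Hj0].
  exact: (le_exponent he htens homega hm_pos ha_pos hb_pos d bound (hm_pos 0%N)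
    A0 Am0 C0 p0 Hj0).
have PT_alpha : PT N -> (0 < alpha)%E.
  move=> [C [p [q [C0 p0 q0 bound]]]]; rewrite lt_neqAle halpha_ge0 andbT.
  apply/eqP => alpha0.
  pose d := (Num.truncn q).+1; have dq : q < d%:R by exact: truncnS_gt.
  have d0 : 0 < d%:R :> R by rewrite ltr0n.
  (* Chosen so that the lower bound becomes d <= q + (d - q) / 2, contradicting q < d. *)
  pose r := (d%:R - q) / (p * L * d%:R).
  have r0 : 0 < r by rewrite divr_gt0 ?subr_gt0// !mulr_gt0.
  have ar : (alpha < r%:E)%E by rewrite -alpha0 lte_fin.
  have := PT_lb C p q d r C0 p0 bound ar.
  have -> : p / 2 * (L * (d%:R * r)) = (d%:R - q) / 2.
    by rewrite /r; field; rewrite !gt_eqF.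
  lra.
have ub r p : m 0 = 1%N -> (r%:E < alpha)%E -> 0 < p -> 1 < L * (p / 2) * r ->
    SPT_exponents N p.
  move=> m0 /(ge_ln_near halpha)[j0 Hj0] p0 pr.
  exact: (SPT_exponents_gt he htens homega hm_pos ha_pos hb_pos ha_nondecreasing
    hm_bounded hb_inf m0 p0 pr Hj0).
have gt_r r p : 0 < r -> 2 / (r * L) < p -> 0 < p /\ 1 < L * (p / 2) * r.
  move=> r0 rp; split.
    by apply: lt_trans rp; rewrite divr_gt0// mulr_gt0.
  move: rp; rewrite ltr_pdivrMr ?mulr_gt0//; lra.
have alpha_SPT : m 0 = 1%N -> (0 < alpha)%E -> SPT N.
  move=> m0 alpha0.
  (* Any positive real below [alpha] serves: half of it if finite, 1 if infinite. *)
  have [r r0 ra] : exists2 r : R, 0 < r & (r%:E < alpha)%E.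
    move: alpha0; case: (alpha) => [x|_|//]; last by exists 1; rewrite ?ltry.
    by rewrite lte_fin => x0; exists (x / 2); rewrite ?lte_fin; lra.
  have [|p0 pr] := gt_r r (2 / (r * L) + 1) r0; first by rewrite ltrDl.
  by exists (2 / (r * L) + 1); exact: ub ra p0 pr.
have PTP : PT N <-> m 0 = 1%N /\ (0 < alpha)%E.
  split=> [pt|[m0 alpha0]]; first by split; [exact: PT_m0|exact: PT_alpha].
  exact/SPT_PT/alpha_SPT.
split=> //.
  by split=> // /PTP[]; exact: alpha_SPT.
move=> spt; have /PTP[m0 alpha0] := SPT_PT spt.
have lb0 : has_lbound (SPT_exponents N) by exists 0 => p [/ltW].
have inf_le x : (forall p, x < p -> SPT_exponents N p) -> SPT_exponent N <= x.
  move=> memP; apply/ler_addgt0Pr => eta eta0.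
  by apply: ge_inf => //; apply: memP; rewrite ltrDl.
apply/eqP; rewrite eq_le.
case: alpha alpha0 halpha halpha_ge0 PT_lb ub {PT_alpha alpha_SPT PTP}
  => [r||//] alpha0 _ _ PT_lb ub; last first.
  apply/andP; split; last by apply: lb_le_inf => // p [/ltW].
  apply: inf_le => p p0.
  (* For infinite [alpha] every [p > 0] is admissible: r = 4 / (p L) makes the threshold 2 / (r L)
     equal to p / 2. *)
  have px : 2 / (4 / (p * L) * L) < p.
    have -> : 2 / (4 / (p * L) * L) = p / 2 by field; rewrite !gt_eqF.
    by rewrite ltr_pdivrMr// ltr_pMr// ltr1n.
  have [] := gt_r (4 / (p * L)) p _ px; first by rewrite divr_gt0// mulr_gt0.
  by move=> _; apply: ub => //; exact: ltry.
have r0 : 0 < r by rewrite -lte_fin.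
have rL0 : 0 < r * L by rewrite mulr_gt0.
apply/andP; split.
  apply: inf_le => p px; have [p0 pr] := gt_r r p r0 px.
  (* the midpoint between [2 / (p L)] and [r] *)
  pose r' := (2 / (p * L) + r) / 2.
  have pLr : 2 / (p * L) < r by rewrite ltr_pdivrMr ?mulr_gt0//; lra.
  apply: (ub r') => //; first by rewrite lte_fin /r'; lra.
  have -> : L * (p / 2) * r' = (1 + L * (p / 2) * r) / 2.
    by rewrite /r'; field; rewrite !gt_eqF.
  lra.
apply: lb_le_inf => // p [p0 [C C0 bound]].
rewrite ler_pdivrMr//; apply/ler_addgt0Pr => eta eta0.
(* The lower bound needs a real strictly above [alpha]; this slack costs eta / 2 after
   multiplication by p L / 2. With d = 1 and q = 0 one gets 2 <= p r L + eta. *)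
have rr : (r%:E < (r + eta / (p * L))%:E)%E.
  by rewrite lte_fin ltrDl divr_gt0// mulr_gt0.
have := PT_lb C p 0 1 _ C0 p0 bound rr.
have -> :
    p / 2 * (L * (1%:R * (r + eta / (p * L)))) = p * (r * L) / 2 + eta / 2.
  by field; rewrite !gt_eqF.
lra.
Qed.
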